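(* For any two points $P,P'\in\mathfrak{H}_{\mathbb{H}}$ there exists a horizontal curve $\gamma:[0,1]\to\mathfrak{H}_{\mathbb{H}}$ with $\gamma(0)=P$ and $\gamma(1)=P'$.
   Context: The quaternionic Heisenberg group $\mathfrak{H}_{\mathbb{H}}$ is, as a manifold, $\mathbb{H}\times\mathrm{Im}\,\mathbb{H}\cong\mathbb{R}^7$, with coordinates $q=x_1+x_2\mathbf{i}+x_3\mathbf{j}+x_4\mathbf{k}\in\mathbb{H}$ and $t=t_1\mathbf{i}+t_2\mathbf{j}+t_3\mathbf{k}\in\mathrm{Im}\,\mathbb{H}$. Its contact form is $\omega=dt-q\cdot d\bar q+dq\cdot\bar q=\theta_1\mathbf{i}+\theta_2\mathbf{j}+\theta_3\mathbf{k}$, where $$\theta_1=dt_1-2x_2dx_1+2x_1dx_2+2x_3dx_4-2x_4dx_3,$$ $$\theta_2=dt_2-2x_3dx_1+2x_1dx_3+2x_4dx_2-2x_2dx_4,$$ $$\theta_3=dt_3-2x_4dx_1+2x_1dx_4+2x_2dx_3-2x_3dx_2.$$ Curves are absolutely continuous maps. A curve $\gamma$ is called horizontal if $\omega(\dot\gamma(\lambda))=0$ for almost every $\lambda$. *)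

(* Defs.v *)
From mathcomp Require Import all_boot all_order all_algebra.
From mathcomp Require Import all_classical all_reals all_analysis.
From mathcomp Require Import ring.

Set Implicit Arguments.
Unset Strict Implicit.
Unset Printing Implicit Defensive.

Import Order.TTheory GRing.Theory Num.Theory.
Import numFieldNormedType.Exports.

Local Open Scope classical_set_scope.
Local Open Scope ring_scope.

(* Rows and pairs carry the sup norm, which is equivalent to the Euclidean one,
   so derivatives and absolute continuity are the usual ones. *)
Notation quat R := 'rV[R]_4.
Notation imquat R := 'rV[R]_3.
Notation qheis R := ('rV[R]_4 * 'rV[R]_3)%type.

Section Quaternions.
Variable R : realType.

(* x1 + x2 i + x3 j + x4 k *)
Definition mkquat (x1 x2 x3 x4 : R) : quat R :=
  \row_(i < 4) [:: x1; x2; x3; x4]`_i.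

Definition x1_ (q : quat R) : R := q 0 0.
Definition x2_ (q : quat R) : R := q 0 1.
Definition x3_ (q : quat R) : R := q 0 2%:R.
Definition x4_ (q : quat R) : R := q 0 3%:R.

Definition t1_ (t : imquat R) : R := t 0 0.
Definition t2_ (t : imquat R) : R := t 0 1.
Definition t3_ (t : imquat R) : R := t 0 2%:R.

(* The inclusion of the imaginary quaternions into the quaternions. *)
Definition im_incl (t : imquat R) : quat R := mkquat 0 (t1_ t) (t2_ t) (t3_ t).

Definition qconj (q : quat R) : quat R :=
  mkquat (x1_ q) (- x2_ q) (- x3_ q) (- x4_ q).

(* Hamilton's product: i^2 = j^2 = k^2 = ijk = -1. *)
Definition qmul (p q : quat R) : quat R :=
  mkquat
    (x1_ p * x1_ q - x2_ p * x2_ q - x3_ p * x3_ q - x4_ p * x4_ q)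
    (x1_ p * x2_ q + x2_ p * x1_ q + x3_ p * x4_ q - x4_ p * x3_ q)
    (x1_ p * x3_ q - x2_ p * x4_ q + x3_ p * x1_ q + x4_ p * x2_ q)
    (x1_ p * x4_ q + x2_ p * x3_ q - x3_ p * x2_ q + x4_ p * x1_ q).

(* [contact_form p v] is the value of dt - q (d qbar) + (dq) qbar at the
   point [p = (q, t)] on the tangent vector [v = (dq, dt)]. *)
Definition contact_form (p v : qheis R) : quat R :=
  im_incl v.2 - qmul p.1 (qconj v.1) + qmul v.1 (qconj p.1).

Lemma contact_formE (p v : qheis R) :
  let x1 := x1_ p.1 in let x2 := x2_ p.1 in
  let x3 := x3_ p.1 in let x4 := x4_ p.1 in
  let dx1 := x1_ v.1 in let dx2 := x2_ v.1 in
  let dx3 := x3_ v.1 in let dx4 := x4_ v.1 in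
  let dt1 := t1_ v.2 in let dt2 := t2_ v.2 in let dt3 := t3_ v.2 in
  contact_form p v = mkquat 0
    (dt1 - 2 * x2 * dx1 + 2 * x1 * dx2 + 2 * x3 * dx4 - 2 * x4 * dx3)
    (dt2 - 2 * x3 * dx1 + 2 * x1 * dx3 + 2 * x4 * dx2 - 2 * x2 * dx4)
    (dt3 - 2 * x4 * dx1 + 2 * x1 * dx4 + 2 * x2 * dx3 - 2 * x3 * dx2).
Proof.
apply/rowP => -[[|[|[|[|//]]]] ?];
  rewrite /contact_form /qmul /qconj /im_incl /mkquat /x1_ /x2_ /x3_ /x4_;
  rewrite !mxE /=; ring.
Qed.

End Quaternions.

Section Curves.
Variable R : realType.

(* A finite family of subintervals of [a, b] is non-overlapping when the open
   intervals are pairwise disjoint. *)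
Definition absolutely_continuous (V : normedModType R) (a b : R)
    (f : R -> V) : Prop :=
  forall e : R, 0 < e -> exists2 d : R, 0 < d &
    forall (n : nat) (u v : 'I_n -> R),
      (forall i, a <= u i /\ u i <= v i /\ v i <= b) ->
      trivIset setT (fun i => `]u i, v i[%classic) ->
      \sum_(i < n) (v i - u i) < d ->
      \sum_(i < n) `|f (v i) - f (u i)| < e.

(* A curve [a, b] -> qheis R is represented by a total function on R, whose
   values outside [a, b] are irrelevant.  Derivability is required because
   [derive1 g] takes a default value where [g] is not derivable; it holds almost
   everywhere for an absolutely continuous [g]. *)
Definition horizontal_curve (a b : R) (g : R -> qheis R) : Prop :=
  absolutely_continuous a b g /\
  {ae @lebesgue_measure R, forall x : R, x \in `[a, b] ->
    derivable g x 1 /\ contact_form (g x) (derive1 g x) = 0}.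

End Curves.

(* Main.v *)
Require Import Defs.
From mathcomp Require Import all_boot all_order all_algebra.
From mathcomp Require Import all_classical all_reals all_analysis.
From mathcomp Require Import ring lra.
Import Order.TTheory GRing.Theory Num.Theory.
Import numFieldNormedType.Exports.
Local Open Scope ring_scope.

(** Horizontality of a curve (q, t) reads t' = omega(q, q'), where
    omega(p, q) = 2 Im (p qbar) is a bilinear alternating form on the
    quaternions: t is determined by q, its starting value, and the area swept
    out by q with respect to omega.  So P and P' are joined as soon as some q
    from P.1 to P'.1 sweeps out the area P'.2 - P.2.

    A polynomial q suffices: take q = P.1 + s d + alpha(s) a + beta(s) b, where
    d = P'.1 - P.1 and alpha, beta vanish at 0 and 1, so that the endpoints do
    not depend on a and b.  By bilinearity and alternation the area of q is
      omega(P.1, d) + (int s alpha' - alpha) omega(d, a)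
        + (int s beta' - beta) omega(d, b)
        + (int alpha beta' - beta alpha') omega(a, b).
    Integrating by parts, int s alpha' - alpha = - 2 int alpha.  Choosing alpha
    and beta of mean zero removes the two middle terms, and with alpha odd and
    beta even about 1/2 the integral of alpha beta' - beta alpha' can still be
    made 1 ([area_profiles]).  It remains to solve omega(a, b) = w for an arbitrary
    imaginary w: a = w / 2 and b = 1 do ([im_bracket_incl1]).

    The resulting curve is a polynomial with coefficients in the normed space
    H x Im H.  It is Lipschitz on bounded intervals, hence absolutely continuous
    ([polycurve_absolutely_continuous]), and differentiable everywhere with the
    derivative computed formally ([is_derive_polycurve]), so that the contact
    form vanishes along it at every point ([contact_form_area_curve]). *)

(** * Lipschitz curves and polynomials *)

Section AbsolutelyContinuous.
Variables (R : realType) (V : normedModType R).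

Lemma lipschitz_absolutely_continuous (a b L : R) (f : R -> V) :
  (forall x y, a <= x <= b -> a <= y <= b -> `|f y - f x| <= L * `|y - x|) ->
  absolutely_continuous a b f.
Proof.
move=> lipf e e0.
have L0 : 0 < `|L| + 1 by rewrite ltr_wpDl.
exists (e / (`|L| + 1)); first exact: divr_gt0.
move=> n u v uv _; rewrite ltr_pdivlMr // => sumlt.
apply: le_lt_trans sumlt; rewrite mulr_suml; apply: ler_sum => i _.
have [au [uvi vb]] := uv i.
apply: le_trans (lipf _ _ _ _) _; first by rewrite au (le_trans uvi).
  by rewrite (le_trans au) //.
rewrite ger0_norm ?subr_ge0 // mulrC ler_wpM2l ?subr_ge0 //.
by rewrite (le_trans (ler_norm L)) // lerDl.
Qed.

End AbsolutelyContinuous.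

(** The bound on the values is part of the statement because the induction
    p |-> p * 'X + c needs it to control the increments of the product. *)
Lemma horner_bounded_lipschitz (R : realDomainType) (p : {poly R}) (M : R) :
  exists K L : R,
    (forall x, `|x| <= M -> `|p.[x]| <= K) /\
    (forall x y, `|x| <= M -> `|y| <= M ->
       `|p.[y] - p.[x]| <= L * `|y - x|).
Proof.
elim/poly_ind: p => [|p c [K [L [pK pL]]]].
  by exists 0, 0; split=> [x _|x y _ _]; rewrite !horner0 ?subr0 ?normr0 ?mul0r.
exists (K * M + `|c|), (K + M * L); split=> [x xM|x y xM yM]; rewrite !hornerE.
  by rewrite (le_trans (ler_normD _ _)) // lerD2r normrM ler_pM // pK.
have -> : p.[y] * y + c - (p.[x] * x + c) =
  p.[y] * (y - x) + x * (p.[y] - p.[x]) by ring.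
rewrite (le_trans (ler_normD _ _)) // !normrM mulrDl lerD //.
  by rewrite ler_wpM2r ?pK.
by rewrite -mulrA ler_pM ?pL.
Qed.

(** * Polynomial curves in a normed space *)

Section PolynomialCurves.
Variables (R : realType) (V : normedModType R).
Implicit Types (c : seq ({poly R} * V)) (x : R).

(** The entry (p, w) contributes p(s) w; real polynomials with vector
    coefficients let derivatives and values be computed term by term. *)
Definition polycurve c x : V := \sum_(pw <- c) pw.1.[x] *: pw.2.

Definition deriv_polycurve c := [seq (pw.1^`()%R, pw.2) | pw <- c].

Lemma polycurve_lipschitz c (M : R) : exists L : R, forall x y,
  `|x| <= M -> `|y| <= M -> `|polycurve c y - polycurve c x| <= L * `|y - x|.
Proof.
elim: c => [|[p w] c [L cL]].
  by exists 0 => x y _ _; rewrite /polycurve !big_nil subr0 normr0 mul0r.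
have [_ [L' [_ pL]]] := horner_bounded_lipschitz _ p M.
exists (L' * `|w| + L) => x y xM yM.
rewrite /polycurve !big_cons /= opprD addrACA -scalerBl.
rewrite (le_trans (ler_normD _ _)) // normrZ mulrDl lerD ?cL //.
by rewrite mulrAC ler_wpM2r ?pL.
Qed.

Lemma polycurve_absolutely_continuous c (a b : R) :
  absolutely_continuous a b (polycurve c).
Proof.
have [L cL] := polycurve_lipschitz c (`|a| + `|b|).
apply: (@lipschitz_absolutely_continuous _ _ _ _ L) => x y xab yab.
have abM z : a <= z <= b -> `|z| <= `|a| + `|b|.
  move=> /andP[az zb]; rewrite ler_norml; apply/andP; split.
    by have := ler_norm (- a); rewrite normrN; have := normr_ge0 b; lra.
  by have := ler_norm b; have := normr_ge0 a; lra.
by apply: cL; apply: abM.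
Qed.

Lemma is_derive_hornerZ (p : {poly R}) (w : V) x :
  is_derive x 1 (fun s => p.[s] *: w) (p^`()%R.[x] *: w).
Proof.
have [/cvg_ex[l pl] <-] := is_derive_poly p x.
have lE := cvg_lim (@Rhausdorff _) pl.
have pwl : ((fun h : R => h^-1 *: (p.[(h *: 1 + x)] *: w - p.[x] *: w))
    @ 0^' --> l *: w)%classic.
  rewrite (_ : (fun h => _) =
    (fun h : R => (h^-1 *: (p.[(h *: 1 + x)] - p.[x])) *: w)); last first.
    by apply/funext => h; rewrite -scalerBl scalerA.
  exact: cvgZr_tmp.
split; first by apply/cvg_ex; exists (l *: w).
by rewrite /derive lE; apply: cvg_lim pwl.
Qed.

Lemma is_derive_polycurve c x :
  is_derive x 1 (polycurve c) (polycurve (deriv_polycurve c) x).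
Proof.
elim: c => [|[p w] c IHc].
  (* The rewriting also reaches the derivative, as [deriv_polycurve [::]]
     reduces to [[::]]. *)
  have -> : polycurve [::] = cst 0.
    by apply/funext => y; rewrite /polycurve /= big_nil.
  by apply: is_derive_cst.
have -> : polycurve ((p, w) :: c) = (fun s => p.[s] *: w) + polycurve c.
  by apply/funext => y; rewrite /polycurve /= big_cons.
have -> : polycurve (deriv_polycurve ((p, w) :: c)) x =
    p^`()%R.[x] *: w + polycurve (deriv_polycurve c) x.
  by rewrite /polycurve big_cons.
by apply: is_deriveD; first exact: is_derive_hornerZ.
Qed.

End PolynomialCurves.
Arguments polycurve {R V}.
Arguments deriv_polycurve {R V}.

(** * The bracket of the group and horizontality *)

Section HorizontalCurves.
Variable R : realType.
Implicit Types (p q v a b d : quat R) (x : R).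

(** This is 2 Im (p qbar), in coordinates. *)
Definition im_bracket p q : imquat R :=
  \row_(k < 3)
    [:: 2 * (x2_ p * x1_ q - x1_ p * x2_ q + x4_ p * x3_ q - x3_ p * x4_ q);
        2 * (x3_ p * x1_ q - x1_ p * x3_ q + x2_ p * x4_ q - x4_ p * x2_ q);
        2 * (x4_ p * x1_ q - x1_ p * x4_ q + x3_ p * x2_ q - x2_ p * x3_ q)]`_k.

Local Ltac im_bracket_ring :=
  apply/rowP => -[[|[|[|//]]] ?];
  rewrite /im_bracket /x1_ /x2_ /x3_ /x4_ !mxE /=; ring.

Lemma contact_form_eq0 (g v : qheis R) :
  v.2 = im_bracket g.1 v.1 -> contact_form g v = 0.
Proof.
move=> vE; apply/rowP => -[[|[|[|[|//]]]] ?];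
  rewrite contact_formE vE /im_bracket /mkquat;
  rewrite /t1_ /t2_ /t3_ /x1_ /x2_ /x3_ /x4_ !mxE /=; ring.
Qed.

Lemma im_bracketDl p p' q :
  im_bracket (p + p') q = im_bracket p q + im_bracket p' q.
Proof. by im_bracket_ring. Qed.

Lemma im_bracketZl (k : R) p q : im_bracket (k *: p) q = k *: im_bracket p q.
Proof. by im_bracket_ring. Qed.

Lemma im_bracketC p q : im_bracket p q = - im_bracket q p.
Proof. by im_bracket_ring. Qed.

Lemma im_bracketxx p : im_bracket p p = 0.
Proof. by im_bracket_ring. Qed.

Lemma im_bracketDr p q q' :
  im_bracket p (q + q') = im_bracket p q + im_bracket p q'.
Proof. by rewrite im_bracketC im_bracketDl opprD -!(im_bracketC p). Qed.

Lemma im_bracketZr (k : R) p q : im_bracket p (k *: q) = k *: im_bracket p q.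
Proof. by rewrite im_bracketC im_bracketZl -scalerN -im_bracketC. Qed.

Lemma imquatE (t : imquat R) : t = \row_(k < 3) [:: t1_ t; t2_ t; t3_ t]`_k.
Proof.
apply/rowP => -[[|[|[|//]]] ?]; rewrite mxE /=;
  by rewrite /t1_ /t2_ /t3_; congr (t 0 _); apply/val_inj.
Qed.

(** The bracket already takes every imaginary value when its second argument
    is the quaternion 1; this is what makes the group bracket generating. *)
Lemma im_bracket_incl1 (t : imquat R) :
  im_bracket (im_incl t) (mkquat 1 0 0 0) = 2 *: t.
Proof.
rewrite [in RHS](imquatE t); apply/rowP => -[[|[|[|//]]] ?];
  rewrite /im_bracket /im_incl /mkquat /x1_ /x2_ /x3_ /x4_;
  rewrite !mxE /=; ring.
Qed.

(** * Curves with a prescribed area *)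

Section AreaCurve.
Variables al be A B C : {poly R}.

(** The curve starting at [P] whose projection to the quaternions is
    P.1 + s d + al(s) a + be(s) b.  The vectors (v, omega(P.1, v)) are the
    values at [P] of the left-invariant horizontal fields; the last three
    entries accumulate the area, [A], [B] and [C] standing for the
    primitives of s al' - al, s be' - be and al be' - be al'. *)
Definition area_curve (P : qheis R) d a b : seq ({poly R} * qheis R) :=
  [:: (1, P); ('X, (d, im_bracket P.1 d));
      (al, (a, im_bracket P.1 a)); (be, (b, im_bracket P.1 b));
      (A, (0, im_bracket d a)); (B, (0, im_bracket d b));
      (C, (0, im_bracket a b))].

Lemma area_curveE P d a b x : polycurve (area_curve P d a b) x =
  (P.1 + (x *: d + al.[x] *: a + be.[x] *: b),
   P.2 + (x *: im_bracket P.1 d + al.[x] *: im_bracket P.1 a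
          + be.[x] *: im_bracket P.1 b + A.[x] *: im_bracket d a
          + B.[x] *: im_bracket d b + C.[x] *: im_bracket a b)).
Proof.
rewrite /polycurve /area_curve !big_cons big_nil /= !hornerE.
case: P => q u /=; congr pair => /=.
  by rewrite !scaler0 !addr0 scale1r -!addrA.
by rewrite !addr0 scale1r -!addrA.
Qed.

Lemma deriv_area_curveE P d a b x :
  polycurve (deriv_polycurve (area_curve P d a b)) x =
  (d + al^`().[x] *: a + be^`().[x] *: b,
   im_bracket P.1 d + al^`().[x] *: im_bracket P.1 a
   + be^`().[x] *: im_bracket P.1 b + A^`().[x] *: im_bracket d a
   + B^`().[x] *: im_bracket d b + C^`().[x] *: im_bracket a b).
Proof.
rewrite /polycurve /deriv_polycurve /= !big_cons big_nil /=.
rewrite derivX -[1]/(1%:P) derivC !hornerE.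
case: P => q u /=; congr pair => /=.
  by rewrite !scaler0 !addr0 scale0r add0r scale1r -!addrA.
by rewrite !addr0 scale0r add0r scale1r -!addrA.
Qed.

(** Expanding omega(q, q') by bilinearity, the squares vanish and the mixed
    terms combine into the derivatives of [A], [B] and [C]. *)
Lemma contact_form_area_curve P d a b x :
  (forall y, A^`().[y] = y * al^`().[y] - al.[y]) ->
  (forall y, B^`().[y] = y * be^`().[y] - be.[y]) ->
  (forall y, C^`().[y] = al.[y] * be^`().[y] - be.[y] * al^`().[y]) ->
  contact_form (polycurve (area_curve P d a b) x)
    (polycurve (deriv_polycurve (area_curve P d a b)) x) = 0.
Proof.
move=> dA dB dC; apply: contact_form_eq0.
rewrite area_curveE deriv_area_curveE /= dA dB dC.
rewrite !(im_bracketDl, im_bracketZl, im_bracketDr, im_bracketZr).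
rewrite !im_bracketxx (im_bracketC a d) (im_bracketC b d) (im_bracketC b a).
move: (im_bracket P.1 d) (im_bracket P.1 a) (im_bracket P.1 b).
move: (im_bracket d a) (im_bracket d b) (im_bracket a b) => da db ab Pd Pa Pb.
by apply/rowP => k; rewrite !mxE; ring.
Qed.

End AreaCurve.
End HorizontalCurves.
Arguments im_bracket {R}.
Arguments area_curve {R}.

(** With u = s (1 - s), the two loops are al = - 35 u (1 - 2 s) and
    be = u (1 - 5 u): both have mean zero, and they have opposite parities about
    1/2, so that the area of the loop (al, be) need not vanish; the factor - 35
    makes it 1.  [A], [B], [C] are the primitives vanishing at 0. *)
Lemma area_profiles (R : realType) : exists al be A B C : {poly R},
  [/\ forall x, A^`()%R.[x] = x * al^`()%R.[x] - al.[x],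
      forall x, B^`()%R.[x] = x * be^`()%R.[x] - be.[x] &
      forall x, C^`()%R.[x] = al.[x] * be^`()%R.[x] - be.[x] * al^`()%R.[x]] /\
  [/\ al.[0] = 0 /\ al.[1] = 0, be.[0] = 0 /\ be.[1] = 0,
      A.[0] = 0 /\ A.[1] = 0, B.[0] = 0 /\ B.[1] = 0 &
      C.[0] = 0 /\ C.[1] = 1].
Proof.
pose al : {poly R} := - (35%:P * 'X) + 105%:P * 'X^2 - 70%:P * 'X^3.
pose be : {poly R} := 'X - 6%:P * 'X^2 + 10%:P * 'X^3 - 5%:P * 'X^4.
pose A : {poly R} := 35%:P * 'X^3 - 35%:P * 'X^4.
pose B : {poly R} := - (2%:P * 'X^3) + 5%:P * 'X^4 - 3%:P * 'X^5.
pose C : {poly R} := 35%:P * 'X^3 - 140%:P * 'X^4 + 231%:P * 'X^5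
                     - 175%:P * 'X^6 + 50%:P * 'X^7.
(* The order matters: [hornerM] would also match the power 'X^n. *)
pose evalE :=
  (hornerXn, hornerMn, hornerX, hornerC, hornerN, hornerD, hornerM).
exists al, be, A, B, C; split; split.
- by move=> x; rewrite /A /al !poly.derivE !evalE; ring.
- by move=> x; rewrite /B /be !poly.derivE !evalE; ring.
- by move=> x; rewrite /C /al /be !poly.derivE !evalE; ring.
- by rewrite /al !evalE; split; ring.
- by rewrite /be !evalE; split; ring.
- by rewrite /A !evalE; split; ring.
- by rewrite /B !evalE; split; ring.
- by rewrite /C !evalE; split; ring.
Qed.

Theorem proposition3p3 (R : realType) (P P' : qheis R) :
  exists g : R -> qheis R, [/\ horizontal_curve 0 1 g, g 0 = P & g 1 = P'].
Proof.
have [al [be [A [B [C [[dA dB dC] [al01 be01 A01 B01 C01]]]]]]] :=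
  area_profiles R.
pose d : quat R := P'.1 - P.1.
(* Half of the area that the straight projection P.1 + s d leaves missing. *)
pose t : imquat R := 2^-1 *: (P'.2 - P.2 - im_bracket P.1 d).
pose c := area_curve al be A B C P d (im_incl t) (mkquat 1 0 0 0).
have hor x : derivable (polycurve c) x 1 /\
    contact_form (polycurve c x) (derive1 (polycurve c) x) = 0.
  have [dc dcE] := is_derive_polycurve _ _ c x.
  by split=> //; rewrite derive1E dcE; apply: contact_form_area_curve.
exists (polycurve c); split.
- split; first exact: polycurve_absolutely_continuous.
  by apply: aeW => x _; apply: hor.
- rewrite area_curveE al01.1 be01.1 A01.1 B01.1 C01.1 !scale0r !addr0.
  by rewrite -surjective_pairing.
rewrite area_curveE al01.2 be01.2 A01.2 B01.2 C01.2 !scale0r !scale1r !addr0.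
rewrite im_bracket_incl1 scalerA divff ?pnatr_eq0 // scale1r.
rewrite [im_bracket _ _ + _]addrC subrK ![P.1 + _]addrC ![P.2 + _]addrC !subrK.
by rewrite -surjective_pairing.
Qed.
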